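(* For any integer $s\ge 2$, the semigroup $LCAT(\Lambda_s^{\mathbb N})$ is maximal commutative.
   Context: $\mathbb N$ includes $0$. $\Lambda_s=\{0,1,\dots,s-1\}$ is identified with the ring $\mathbb Z/s\mathbb Z$ (discrete topology), and $\Lambda_s^{\mathbb N}$ is the space of one-sided sequences $a=a_0a_1a_2\dots$ with the product topology and its coordinatewise $\Lambda_s$-module structure. $\sigma$ is the left shift, $\sigma(a)_k=a_{k+1}$. $CAT(\Lambda_s^{\mathbb N})$ is the semigroup (under composition) of all continuous maps $\tau:\Lambda_s^{\mathbb N}\to\Lambda_s^{\mathbb N}$ with $\tau\sigma=\sigma\tau$, and $LCAT(\Lambda_s^{\mathbb N})$ is the sub-semigroup of those elements that are $\Lambda_s$-linear. A semigroup $\Sigma\subset CAT(\Lambda_s^{\mathbb N})$ is maximal commutative (MC) if (1) $\Sigma$ is commutative, and (2) every $\mu\in CAT(\Lambda_s^{\mathbb N})$ with $\mu\tau=\tau\mu$ for all $\tau\in\Sigma$ belongs to $\Sigma$. *)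

(* Defs.v *)
From HB Require Import structures.
From mathcomp Require Import all_boot all_order all_algebra.
From mathcomp Require Import boolp classical_sets functions topology.

Set Implicit Arguments.
Unset Strict Implicit.
Unset Printing Implicit Defensive.

Import GRing.Theory.

Local Open Scope classical_set_scope.
Local Open Scope ring_scope.

(* ['Z_s] is Z/sZ only when [1 < s]; for s < 2 it is Z/2Z. *)
Definition Lambda (s : nat) : Type := discrete_topology 'Z_s.

HB.instance Definition _ (s : nat) :=
  DiscreteTopology.copy (Lambda s) (discrete_topology 'Z_s).
HB.instance Definition _ (s : nat) :=
  GRing.Lmodule.copy (Lambda s) ('Z_s)^o.

Definition config (s : nat) : Type := prod_topology (fun _ : nat => Lambda s).

HB.instance Definition _ (s : nat) := Topological.on (config s).
HB.instance Definition _ (s : nat) :=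
  GRing.Lmodule.copy (config s) (nat -> Lambda s).

Definition shift (s : nat) (a : config s) : config s := fun k => a k.+1.

Definition CAT (s : nat) : set (config s -> config s) :=
  [set tau | continuous tau /\ tau \o @shift s = @shift s \o tau].

(* [linear] is linearity over the scalar ring ['Z_s]. *)
Definition LCAT (s : nat) : set (config s -> config s) :=
  [set tau | CAT tau /\ linear tau].

Definition subsemigroup_CAT (s : nat) (Sigma : set (config s -> config s)) :=
  Sigma `<=` @CAT s /\
  (forall tau mu, Sigma tau -> Sigma mu -> Sigma (tau \o mu)).

Definition commutative_family (s : nat) (Sigma : set (config s -> config s)) :=
  forall tau mu, Sigma tau -> Sigma mu -> tau \o mu = mu \o tau.

Definition maximal_commutative (s : nat) (Sigma : set (config s -> config s)) :=
  [/\ subsemigroup_CAT Sigma,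
      commutative_family Sigma &
      forall mu, CAT mu ->
        (forall tau, Sigma tau -> mu \o tau = tau \o mu) -> Sigma mu].

(* Main.v *)
Require Import Defs.
From mathcomp Require Import all_boot all_algebra.
From HB Require Import structures.
From mathcomp Require Import mathcomp_extra boolp classical_sets functions topology.

(** A linear [tau] that is continuous at 0 is a finite combination
    [a |-> \sum_(i < n) c i *: sigma^i a], so it commutes with every linear map
    commuting with the shift.  Conversely, let [mu] commute with all linear
    cellular automata, in particular with [id + sigma^n].  Given [a] and [b],
    let [a'] consist of the first [n] entries of [a] followed by [b], so that
    [sigma^n a' = b].  For [n] large, continuity of [mu] at [a] and [a + b] turns
    [mu (a' + sigma^n a') = mu a' + sigma^n (mu a')] into
    [mu (a + b) = mu a + mu b] at coordinate 0, hence, by shifting, at every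
    coordinate. *)

Set Implicit Arguments.
Unset Strict Implicit.
Unset Printing Implicit Defensive.

Import GRing.Theory.

Local Open Scope classical_set_scope.
Local Open Scope ring_scope.

Section Config.
Variable s : nat.
Implicit Types (a b : config s) (tau mu : config s -> config s).

(** The product topology is the coarsest one making all coordinates continuous, and points of
    [Lambda s] are open. *)
Lemma cvg_configP (F : set_system (config s)) a : Filter F ->
  F --> a <-> forall k, F [set b | b k = a k].
Proof.
move=> FF; split=> [Fa k|Fa].
  pose K (_ : nat) : topologicalType := Lambda s.
  apply: Fa; apply: (@proj_continuous _ K k a [set b | b = a k]).
  exact: discrete_set1.
apply/cvg_sup => k U [_ [[W oW <-] Wa WU]].
by apply: filterS (Fa k) => b bk; apply: WU; rewrite /= bk.
Qed.

(** By [cvg_configP], the filter generated by the cylinders around [a] converges to [a], so it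
    contains every neighbourhood of [a]. *)
Lemma nbhs_config_cylinder a (A : set (config s)) : nbhs a A ->
  exists n, forall b, (forall i, (i < n)%N -> b i = a i) -> A b.
Proof.
pose cyl n := [set b | forall i, (i < n)%N -> b i = a i].
have cylF : Filter (filter_from setT cyl).
  apply: filter_from_filter; first by exists 0%N.
  move=> m n _ _; exists (maxn m n) => // b bE.
  by split=> i lt_i; apply: bE; rewrite leq_max lt_i ?orbT.
have : filter_from setT cyl --> a.
  apply/cvg_configP => k; exists k.+1 => // b bE; exact: bE.
by move=> cvg_a /cvg_a [n _ nA]; exists n => b /nA.
Qed.

Lemma continuous_configP tau : continuous tau <->
  forall a k, \forall b \near a, tau b k = tau a k.
Proof.
split=> [ctau a k|tauP a].
  exact: (cvg_configP _ (fmap_filter _ (nbhs_filter a))).1 (ctau a) k.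
exact: (cvg_configP _ (fmap_filter _ (nbhs_filter a))).2 (tauP a).
Qed.

Lemma continuous_config_local tau a k : continuous tau ->
  exists n, forall b, (forall i, (i < n)%N -> b i = a i) -> tau b k = tau a k.
Proof.
move=> /continuous_configP ctau.
exact: (nbhs_config_cylinder (ctau a k)).
Qed.

Lemma near_coord a k : \forall b \near a, b k = a k.
Proof. exact: (cvg_configP _ (nbhs_filter _)).1 (@cvg_id _ (nbhs a)) k. Qed.

Lemma config_addE a b k : (a + b) k = a k + b k.
Proof. by []. Qed.

Lemma config_scaleE (c : 'Z_s) a k : (c *: a) k = c *: a k.
Proof. by []. Qed.

Lemma config_sumE n (F : 'I_n -> config s) k :
  (\sum_i F i) k = \sum_i F i k.
Proof. exact: (big_morph (fun b : config s => b k)). Qed.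

Lemma iter_shiftE n a k : iter n (@shift s) a k = a (k + n)%N.
Proof. by elim: n k => [|n IHn] k; rewrite ?addn0 //= /shift IHn addSnnS. Qed.

Lemma CAT_iter_shift tau n a : CAT tau ->
  tau (iter n (@shift s) a) = iter n (@shift s) (tau a).
Proof.
move=> [_ tauS]; elim: n => //= n <-.
exact: (congr1 (fun f => f _) tauS).
Qed.

(** Lets a cellular automaton be studied at coordinate 0 alone. *)
Lemma CAT_coord tau a k : CAT tau -> tau a k = tau (iter k (@shift s) a) 0%N.
Proof. by move=> ?; rewrite CAT_iter_shift// iter_shiftE. Qed.

Lemma CAT_comp tau mu : CAT tau -> CAT mu -> CAT (tau \o mu).
Proof.
move=> [ctau tauS] [cmu muS]; split.
  by move=> a; apply: continuous_comp; [exact: cmu|exact: ctau].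
by rewrite -compA muS compA tauS.
Qed.

Lemma LCAT_comp tau mu : LCAT tau -> LCAT mu -> LCAT (tau \o mu).
Proof.
move=> [ctau ltau] [cmu lmu]; split; first exact: CAT_comp.
by move=> c a b /=; rewrite lmu ltau.
Qed.

Lemma LCAT_add_iter_shift n : LCAT (fun a => a + iter n (@shift s) a).
Proof.
split; first split.
- apply/continuous_configP => a k.
  near=> b; rewrite !config_addE !iter_shiftE.
  by congr (_ + _); near: b; exact: near_coord.
- apply/funext => a; apply/funext => k.
  by rewrite /= /shift !config_addE !iter_shiftE.
- move=> c a b; rewrite scalerDr addrACA; congr (_ + _).
  by apply/funext => k; rewrite config_addE config_scaleE !iter_shiftE.
Unshelve. all: by end_near. Qed.

(** Linear because ['Z_s] is commutative. Commuting with these maps is homogeneity. *)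
Lemma LCAT_scale (c : 'Z_s) : LCAT (fun a => c *: a).
Proof.
split; first split.
- apply/continuous_configP => a k.
  by apply: filterS (near_coord a k) => b bk; rewrite !config_scaleE bk.
- by [].
- by move=> d a b; rewrite scalerDr !scalerA mulrC.
Qed.

Lemma LCAT_sum_iter_shift tau : LCAT tau -> exists n (c : nat -> 'Z_s),
  forall a, tau a = \sum_(i < n) c i *: iter i (@shift s) a.
Proof.
move=> [Ctau ltau].
pose L : {linear config s -> config s} :=
  HB.pack tau (GRing.isLinear.Build _ _ _ _ tau ltau).
have [n nP] := continuous_config_local 0 0 Ctau.1.
pose e i : config s := fun j => (j == i)%:R : 'Z_s.
(* Coordinate 0 of [tau] is a linear form in the first [n] entries; its coefficients are read off on
   the unit sequences [e i]. *)
exists n, (fun i => tau (e i) 0%N) => a.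
apply/funext => k; rewrite CAT_coord//; set b := iter k _ a.
(* [t] is [b] cut off after its first [n] entries, so [b - t] agrees with 0 there. *)
pose t : config s := \sum_(i < n) (b i : 'Z_s) *: e i.
have tE j : (j < n)%N -> t j = b j.
  move=> lt_jn; rewrite /t config_sumE (bigD1 (Ordinal lt_jn)) //= big1 ?addr0.
    by rewrite config_scaleE /e eqxx; exact: mulr1.
  move=> i; rewrite -val_eqE eq_sym config_scaleE /e => /negPf /= ->.
  exact: mulr0.
have r0 : L (b - t) 0%N = 0.
  rewrite -[RHS]/((0 : config s) 0%N) -(linear0 L); apply: nP => i lt_in.
  by rewrite config_addE -tE // -config_addE subrr.
rewrite -[tau]/(L : _ -> _) -[b](subrK t) linearD config_addE r0 add0r.
rewrite linear_sum !config_sumE; apply: eq_bigr => i _.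
rewrite linearZ !config_scaleE iter_shiftE [b i]iter_shiftE addnC /=.
exact: mulrC.
Qed.

(** Only [tau] is expanded: [mu] passes through the sum and the scalars by linearity, and through
    powers of the shift as a cellular automaton. *)
Lemma LCAT_commute tau mu : LCAT tau -> LCAT mu -> tau \o mu = mu \o tau.
Proof.
move=> /LCAT_sum_iter_shift[n [c tauE]] [Cmu lmu].
pose M : {linear config s -> config s} :=
  HB.pack mu (GRing.isLinear.Build _ _ _ _ mu lmu).
apply/funext => a; rewrite /= !tauE -[mu]/(M : _ -> _) linear_sum.
by apply: eq_bigr => i _; rewrite linearZ -CAT_iter_shift.
Qed.

Lemma CAT_additive_of_commute mu : CAT mu ->
  (forall n a, mu (a + iter n (@shift s) a) = mu a + iter n (@shift s) (mu a)) ->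
  forall a b, mu (a + b) = mu a + mu b.
Proof.
move=> Cmu muD.
have mu0 a b : mu (a + b) 0%N = (mu a + mu b) 0%N.
  have [m mP] := continuous_config_local a 0 Cmu.1.
  have [n nP] := continuous_config_local (a + b) 0 Cmu.1.
  (* [N] covers both windows: [m] compares [a'] with [a], and [n] compares [a' + b] with [a + b]. *)
  pose N := maxn m n.
  pose a' : config s := fun i => if (i < N)%N then a i else b (i - N)%N.
  have a'a i : (i < N)%N -> a' i = a i by rewrite /a' => ->.
  have a'b : iter N (@shift s) a' = b.
    by apply/funext => k; rewrite iter_shiftE /a' ltnNge leq_addl /= addnK.
  have <- : mu (a' + b) 0%N = mu (a + b) 0%N.
    apply: nP => i lt_in; rewrite !config_addE a'a //.
    by rewrite leq_max lt_in orbT.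
  (* The shifted term is exactly [mu b]; only [mu a'] is replaced by locality at [a]. *)
  rewrite -{1}a'b muD -CAT_iter_shift// a'b config_addE; congr (_ + _).
  by apply: mP => i lt_im; apply: a'a; rewrite leq_max lt_im.
move=> a b; apply/funext => k.
rewrite config_addE !(CAT_coord _ k)// -config_addE -mu0; congr (mu _ _).
by apply/funext => j; rewrite config_addE !iter_shiftE.
Qed.

End Config.

Theorem theorem3p4 (s : nat) (hs : (1 < s)%N) : maximal_commutative (@LCAT s).
Proof.
split=> [|tau mu|mu Cmu mu_comm].
- by split=> [tau []|tau mu] //; exact: LCAT_comp.
- exact: LCAT_commute.
have muD : forall a b, mu (a + b) = mu a + mu b.
  apply: CAT_additive_of_commute => // n a.
  exact: (congr1 (fun f => f a) (mu_comm _ (LCAT_add_iter_shift s n))).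
split=> // c a b; rewrite muD; congr (_ + _).
exact: (congr1 (fun f => f a) (mu_comm _ (LCAT_scale c))).
Qed.
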